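(* The $2$-category $\mathbf{rCat}$ admits (localic, hyperconnected) factorisations: every restriction functor $F\colon\mathcal{C}\to\mathcal{D}$ between restriction categories factors as $F=KH$ with $H\colon\mathcal{C}\to\mathcal{E}$ a localic restriction functor and $K\colon\mathcal{E}\to\mathcal{D}$ a hyperconnected restriction functor, for some restriction category $\mathcal{E}$.
   Context: A restriction category is a category $\mathcal{C}$ with an operation assigning to each $f\colon A\to B$ a map $\bar f\colon A\to A$ such that: (R1) $f\bar f=f$; (R2) $\bar f\bar g=\bar g\bar f$ for $f\colon A\to B$, $g\colon A\to C$; (R3) $\overline{g\bar f}=\bar g\bar f$ for $f\colon A\to B$, $g\colon A\to C$; (R4) $\bar g f=f\,\overline{gf}$ for $f\colon A\to B$, $g\colon B\to C$. A restriction functor is a functor with $F\bar f=\overline{Ff}$. A map $f\colon A\to B$ is total if $\bar f=1_A$; a natural transformation is total if all its components are. $\mathbf{rCat}$ is the $2$-category of restriction categories, restriction functors and total natural transformations. Each homset is partially ordered by $f\leqslant g$ iff $g\bar f=f$. A restriction idempotent on $A$ is an endomorphism $e$ of $A$ with $\bar e=e$; $\mathcal{O}(A)$ is the set of these. A restriction functor $F\colon\mathcal{C}\to\mathcal{D}$ is hyperconnected if for each $A\in\mathcal{C}$ the map $\mathcal{O}(A)\to\mathcal{O}(FA)$, $e\mapsto Fe$, is an isomorphism (bijection). It is localic if it is bijective on objects and for every map $g\colon FA\to FB$ in $\mathcal{D}$ the poset of maps $f\colon A\to B$ in $\mathcal{C}$ with $g\leqslant Ff$ is downwards-directed (in particular,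 nonempty). *)

(* Defs.v *)
From Corelib Require Import ssreflect ssrfun.

Set Implicit Arguments.
Unset Strict Implicit.
Unset Printing Implicit Defensive.

Declare Scope rcat_scope.
Delimit Scope rcat_scope with rcat.
Local Open Scope rcat_scope.

Record category := Category {
  ob :> Type;
  hom : ob -> ob -> Type;
  idm : forall A, hom A A;
  comp : forall A B C, hom B C -> hom A B -> hom A C;
  comp1m : forall A B (f : hom A B), comp (idm B) f = f;
  compm1 : forall A B (f : hom A B), comp f (idm A) = f;
  compmA : forall A B C D (h : hom C D) (g : hom B C) (f : hom A B),
    comp h (comp g f) = comp (comp h g) f
}.

Arguments hom {c} A B.
Arguments idm {c} A.
Arguments comp {c A B C} g f.

Notation "A ~> B" := (hom A B) (at level 99, B at level 200) : rcat_scope.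
Notation "g ∘ f" := (comp g f) (at level 40, left associativity) : rcat_scope.

Record restriction_category := RestrictionCategory {
  rcat_cat :> category;
  restr : forall A B : rcat_cat, (A ~> B) -> (A ~> A);
  restrR1 : forall (A B : rcat_cat) (f : A ~> B), f ∘ restr f = f;
  restrR2 : forall (A B C : rcat_cat) (f : A ~> B) (g : A ~> C),
    restr f ∘ restr g = restr g ∘ restr f;
  restrR3 : forall (A B C : rcat_cat) (f : A ~> B) (g : A ~> C),
    restr (g ∘ restr f) = restr g ∘ restr f;
  restrR4 : forall (A B C : rcat_cat) (f : A ~> B) (g : B ~> C),
    restr g ∘ f = f ∘ restr (g ∘ f)
}.

Arguments restr {r A B} f.

Record functor (C D : category) := Functor {
  fob :> C -> D;
  fmap : forall A B : C, (A ~> B) -> (fob A ~> fob B);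
  fmap1 : forall A : C, fmap (idm A) = idm (fob A);
  fmapM : forall (X Y Z : C) (g : Y ~> Z) (f : X ~> Y),
    fmap (g ∘ f) = fmap g ∘ fmap f
}.

Arguments fmap {C D} F {A B} f : rename.

Record restriction_functor (C D : restriction_category) := RestrictionFunctor {
  rfunctor_functor :> functor C D;
  fmap_restr : forall (A B : C) (f : A ~> B),
    fmap rfunctor_functor (restr f) = restr (fmap rfunctor_functor f)
}.

Definition functor_comp (C D E : category)
    (G : functor D E) (F : functor C D) : functor C E.
Proof.
refine (@Functor C E (fun A => G (F A))
  (fun A B f => fmap G (fmap F f)) _ _).
- by move=> A; rewrite !fmap1.
- by move=> X Y Z g f; rewrite !fmapM.
Defined.

Definition rfunctor_comp (C D E : restriction_category)
    (G : restriction_functor D E) (F : restriction_functor C D) :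
  restriction_functor C E.
Proof.
refine (@RestrictionFunctor C E (functor_comp G F) _).
by move=> A B f /=; rewrite !fmap_restr.
Defined.

Definition rle (C : restriction_category) (A B : C) (f g : A ~> B) : Prop :=
  g ∘ restr f = f.

Notation "f ⩽ g" := (rle f g) (at level 70, no associativity) : rcat_scope.

Definition is_ridem (C : restriction_category) (A : C) (e : A ~> A) : Prop :=
  restr e = e.

Definition ridem (C : restriction_category) (A : C) : Type :=
  {e : A ~> A | is_ridem e}.

Lemma fmap_ridem (C D : restriction_category) (F : restriction_functor C D)
    (A : C) (e : A ~> A) : is_ridem e -> is_ridem (fmap F e).
Proof. by rewrite /is_ridem -fmap_restr => ->. Qed.

Definition ridem_map (C D : restriction_category)
    (F : restriction_functor C D) (A : C) (e : ridem A) : ridem (F A) :=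
  exist _ (fmap F (proj1_sig e)) (fmap_ridem F (proj2_sig e)).

Definition hyperconnected (C D : restriction_category)
    (F : restriction_functor C D) : Prop :=
  forall A : C, bijective (@ridem_map C D F A).

Definition downwards_directed (C : restriction_category) (A B : C)
    (P : (A ~> B) -> Prop) : Prop :=
  (exists f, P f) /\
  (forall f g, P f -> P g -> exists h, P h /\ h ⩽ f /\ h ⩽ g).

Definition localic (C D : restriction_category)
    (F : restriction_functor C D) : Prop :=
  bijective (fob F) /\
  forall (A B : C) (g : F A ~> F B),
    downwards_directed (fun f : A ~> B => g ⩽ fmap F f).

(* Main.v *)
Require Import Defs.
From Corelib Require Import ssreflect ssrfun ssrbool.
From Stdlib Require Import FunctionalExtensionality PropExtensionality.
From Stdlib Require Import ProofIrrelevance.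

(** The middle category [E] has the objects of [C].  For the first factor to
    be localic, each map [A ~> B] of [E] has to be a restriction of a map of
    [C]; for the second to be hyperconnected, the available domains of
    restriction have to be the restriction idempotents of [D] on [F A].  So a
    map of [E] is a formal restriction of some [f : A ~> B] to an idempotent
    [e] below [F (restr f)], and two maps [f], [g] of [C] restrict to the same
    thing on [e] when they already agree on a larger domain coming from [C],
    i.e. have a common lower bound [h] with [e] below [F (restr h)].

    The idempotent is recovered from the map [k = F f ∘ e] of [D], as
    [e = restr k], and the condition on [e] then reads [k ⩽ F f].  Hence a
    germ is a map [k] together with the class of some [f] with [k ⩽ F f] for
    the relation [agree_below k]; the latter is transitive because two maps
    with an upper bound have a meet, which [F] preserves.  Composition and
    restriction act on representatives ([germ_comp_mk], [germ_restr_mk]), so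
    the axioms of a restriction category hold in [E] because they hold in [C]
    and [D].

    Every [f] represents the germ of [F f], which gives [C -> E]; the
    projection [germ_val] gives [E -> D], and the composite is [F] on the nose.
    The maps [f] of [C] above a germ are exactly the members of its class
    ([germ_rle_localic_map]), and a class is directed by meets; this is
    localicity.  An idempotent germ is represented by its own restriction,
    which agrees with the identity, so it is determined by its underlying
    idempotent of [D]; this is hyperconnectedness. *)

Set Implicit Arguments.
Unset Strict Implicit.
Unset Printing Implicit Defensive.

Local Open Scope rcat_scope.

(** * The order on the maps of a restriction category *)

Section RestrictionOrder.

Context (C : restriction_category).

Lemma restr_idm (A : C) : restr (idm A) = idm A.
Proof. by rewrite -[LHS]comp1m restrR1. Qed.

Lemma restr_restr (A B : C) (f : A ~> B) : restr (restr f) = restr f.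
Proof. by rewrite -{1}[restr f]comp1m restrR3 restr_idm comp1m. Qed.

Lemma restr_comp_restr (A B X : C) (g : B ~> X) (f : A ~> B) :
  restr f ∘ restr (g ∘ f) = restr (g ∘ f).
Proof. by rewrite restrR2 -restrR3 -compmA restrR1. Qed.

Lemma rle_refl (A B : C) (f : A ~> B) : f ⩽ f.
Proof. exact: restrR1. Qed.

Lemma rle_restr (A B : C) (f g : A ~> B) : f ⩽ g -> restr f ⩽ restr g.
Proof. by rewrite /rle restr_restr -restrR3 => ->. Qed.

Lemma rle_trans (A B : C) (g f h : A ~> B) : f ⩽ g -> g ⩽ h -> f ⩽ h.
Proof.
move=> fg gh; have := rle_restr fg; rewrite /rle restr_restr => eq_fg.
by rewrite /rle -eq_fg compmA gh fg.
Qed.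

Lemma rle_comp (A B X : C) (g g' : B ~> X) (f f' : A ~> B) :
  g ⩽ g' -> f ⩽ f' -> g ∘ f ⩽ g' ∘ f'.
Proof.
rewrite /rle => gg' ff'.
by rewrite -restr_comp_restr compmA -(compmA g') ff' -compmA -restrR4 compmA gg'.
Qed.

Lemma rle_comp_restr (A B X : C) (g : A ~> B) (f : A ~> X) : g ∘ restr f ⩽ g.
Proof. by rewrite /rle restrR3 compmA restrR1. Qed.

Lemma restr_rle_idm (A B : C) (f : A ~> B) : restr f ⩽ idm A.
Proof. by rewrite /rle comp1m restr_restr. Qed.

(** Maps with a common upper bound [p] have the meet
    [f ∘ restr g = g ∘ restr f], since both sides restrict [p] to the same
    domain. *)
Lemma bounded_comp_restrC (A B : C) (p f g : A ~> B) :
  f ⩽ p -> g ⩽ p -> f ∘ restr g = g ∘ restr f.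
Proof.
by rewrite /rle => fp gp; rewrite -{1}fp -{2}gp -!compmA restrR2.
Qed.

Lemma rle_meet (A B : C) (f g k : A ~> B) :
  k ⩽ f -> k ⩽ g -> k ⩽ f ∘ restr g.
Proof.
move=> kf /rle_restr; rewrite /rle restr_restr => kg.
by rewrite /rle -compmA kg.
Qed.

End RestrictionOrder.

Lemma fmap_rle (C D : restriction_category) (F : restriction_functor C D)
    (A B : C) (f g : A ~> B) : f ⩽ g -> fmap F f ⩽ fmap F g.
Proof. by rewrite /rle -fmap_restr -fmapM => ->. Qed.

(** * Germs *)

Section Germs.

Context (C D : restriction_category) (F : restriction_functor C D).

(** For [k] below both [fmap F f] and [fmap F g], this says that [f] and [g]
    have the same germ on the domain of [k]. *)
Definition agree_below (A B : C) (k : F A ~> F B) (f g : A ~> B) : Prop :=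
  exists h, [/\ h ⩽ f, h ⩽ g & k ⩽ fmap F h].

Lemma agree_below_refl (A B : C) (k : F A ~> F B) (f : A ~> B) :
  k ⩽ fmap F f -> agree_below k f f.
Proof. by exists f; split=> //; exact: rle_refl. Qed.

Lemma agree_below_sym (A B : C) (k : F A ~> F B) (f g : A ~> B) :
  agree_below k f g -> agree_below k g f.
Proof. by case=> h [? ? ?]; exists h. Qed.

(** The two witnesses are both below [g], so they have a meet, and this meet
    is preserved by [F]. *)
Lemma agree_below_trans (A B : C) (k : F A ~> F B) (g f p : A ~> B) :
  agree_below k f g -> agree_below k g p -> agree_below k f p.
Proof.
case=> h [hf hg kh] [h' [h'g h'p kh']]; exists (h ∘ restr h'); split.
- exact: rle_trans (rle_comp_restr h h') hf.
- rewrite (bounded_comp_restrC hg h'g).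
  exact: rle_trans (rle_comp_restr h' h) h'p.
- by rewrite fmapM fmap_restr; apply: rle_meet.
Qed.

Lemma agree_below_comp (A B X : C) (l : F B ~> F X) (k : F A ~> F B)
    (q q' : B ~> X) (p p' : A ~> B) :
  agree_below l q q' -> agree_below k p p' ->
  agree_below (l ∘ k) (q ∘ p) (q' ∘ p').
Proof.
case=> h [hq hq' lh] [j [jp jp' kj]]; exists (h ∘ j).
by split; rewrite ?fmapM; apply: rle_comp.
Qed.

Lemma agree_below_restr (A B : C) (k : F A ~> F B) (p p' : A ~> B) :
  agree_below k p p' -> agree_below (restr k) (restr p) (restr p').
Proof.
case=> j [jp jp' kj]; exists (restr j).
by split; rewrite ?fmap_restr; apply: rle_restr.
Qed.

(** A quotient of the pairs [(k, f)] with [k ⩽ fmap F f], presented by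
    equivalence classes.  The component [k] is constant on a class, so that it
    can be projected without choosing a representative. *)
Record germ (A B : C) := Germ {
  germ_val : F A ~> F B;
  germ_class : (A ~> B) -> Prop;
  germ_classP : exists f,
    germ_val ⩽ fmap F f /\ germ_class = agree_below germ_val f
}.

Definition mk_germ (A B : C) (k : F A ~> F B) (f : A ~> B)
    (kf : k ⩽ fmap F f) : germ A B :=
  Germ (ex_intro _ f (conj kf erefl)).

Lemma germ_ext (A B : C) (m n : germ A B) :
  germ_val m = germ_val n -> germ_class m = germ_class n -> m = n.
Proof.
case: m n => [k P mP] [l Q nP] /= kl PQ.
by case: l / kl nP => nP; case: Q / PQ nP => nP;
   rewrite (proof_irrelevance _ mP nP).
Qed.

Lemma agree_below_class (A B : C) (k : F A ~> F B) (f g : A ~> B) :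
  agree_below k f g -> agree_below k f = agree_below k g.
Proof.
move=> fg; apply: functional_extensionality => p.
apply: propositional_extensionality; split; apply: agree_below_trans => //.
exact: agree_below_sym.
Qed.

Lemma mk_germ_eq (A B : C) (k l : F A ~> F B) (f g : A ~> B)
    (kf : k ⩽ fmap F f) (lg : l ⩽ fmap F g) :
  k = l -> agree_below k f g -> mk_germ kf = mk_germ lg.
Proof.
by move=> kl fg; apply: germ_ext; rewrite //= (agree_below_class fg) kl.
Qed.

Lemma mk_germ_congr (A B : C) (k l : F A ~> F B) (f g : A ~> B)
    (kf : k ⩽ fmap F f) (lg : l ⩽ fmap F g) :
  k = l -> f = g -> mk_germ kf = mk_germ lg.
Proof.
move=> kl fg; apply: mk_germ_eq => //.
by rewrite -fg; apply: agree_below_refl.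
Qed.

Lemma germ_mkP (A B : C) (m : germ A B) :
  exists k f (kf : k ⩽ fmap F f), m = mk_germ kf.
Proof.
have [f [kf mf]] := germ_classP m.
by exists (germ_val m), f, kf; apply: germ_ext.
Qed.

Lemma idm_rle (A : C) : idm (F A) ⩽ fmap F (idm A).
Proof. by rewrite fmap1; apply: rle_refl. Qed.

Lemma comp_rle (A B X : C) (l : F B ~> F X) (q : B ~> X) (k : F A ~> F B)
    (p : A ~> B) :
  l ⩽ fmap F q -> k ⩽ fmap F p -> l ∘ k ⩽ fmap F (q ∘ p).
Proof. by rewrite fmapM; apply: rle_comp. Qed.

Lemma restr_rle (A B : C) (k : F A ~> F B) (p : A ~> B) :
  k ⩽ fmap F p -> restr k ⩽ fmap F (restr p).
Proof. by rewrite fmap_restr; apply: rle_restr. Qed.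

(** * The restriction category of germs *)

(** Quantifying over all representatives avoids choosing them;
    [comp_class_mk] is the independence of the choice. *)
Definition comp_class (A B X : C) (n : germ B X) (m : germ A B)
    (f : A ~> X) : Prop :=
  exists q p, [/\ germ_class n q, germ_class m p &
    agree_below (germ_val n ∘ germ_val m) (q ∘ p) f].

Lemma comp_class_mk (A B X : C) (l : F B ~> F X) (q : B ~> X)
    (lq : l ⩽ fmap F q) (k : F A ~> F B) (p : A ~> B) (kp : k ⩽ fmap F p) :
  comp_class (mk_germ lq) (mk_germ kp) = agree_below (l ∘ k) (q ∘ p).
Proof.
apply: functional_extensionality => f.
apply: propositional_extensionality; split; last first.
  by exists q, p; split=> //; apply: agree_below_refl.
case=> q' [p' [/= qq' pp']]; apply: agree_below_trans.
exact: agree_below_comp.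
Qed.

Lemma comp_classP (A B X : C) (n : germ B X) (m : germ A B) :
  exists f, germ_val n ∘ germ_val m ⩽ fmap F f /\
    comp_class n m = agree_below (germ_val n ∘ germ_val m) f.
Proof.
have [l [q [lq ->]]] := germ_mkP n; have [k [p [kp ->]]] := germ_mkP m.
by exists (q ∘ p); split; [apply: comp_rle | apply: comp_class_mk].
Qed.

Definition germ_comp (A B X : C) (n : germ B X) (m : germ A B) : germ A X :=
  Germ (comp_classP n m).

Lemma germ_comp_mk (A B X : C) (l : F B ~> F X) (q : B ~> X)
    (lq : l ⩽ fmap F q) (k : F A ~> F B) (p : A ~> B) (kp : k ⩽ fmap F p) :
  germ_comp (mk_germ lq) (mk_germ kp) = mk_germ (comp_rle lq kp).
Proof. by apply: germ_ext => //=; apply: comp_class_mk. Qed.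

Definition restr_class (A B : C) (m : germ A B) (e : A ~> A) : Prop :=
  exists2 p, germ_class m p & agree_below (restr (germ_val m)) (restr p) e.

Lemma restr_class_mk (A B : C) (k : F A ~> F B) (p : A ~> B)
    (kp : k ⩽ fmap F p) :
  restr_class (mk_germ kp) = agree_below (restr k) (restr p).
Proof.
apply: functional_extensionality => e.
apply: propositional_extensionality; split; last first.
  by exists p => //; apply: agree_below_refl.
case=> p' /= pp'; apply: agree_below_trans; exact: agree_below_restr.
Qed.

Lemma restr_classP (A B : C) (m : germ A B) :
  exists f, restr (germ_val m) ⩽ fmap F f /\
    restr_class m = agree_below (restr (germ_val m)) f.
Proof.
have [k [p [kp ->]]] := germ_mkP m.
by exists (restr p); split; [apply: restr_rle | apply: restr_class_mk].
Qed.

Definition germ_restr (A B : C) (m : germ A B) : germ A A :=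
  Germ (restr_classP m).

Lemma germ_restr_mk (A B : C) (k : F A ~> F B) (p : A ~> B)
    (kp : k ⩽ fmap F p) :
  germ_restr (mk_germ kp) = mk_germ (restr_rle kp).
Proof. by apply: germ_ext => //=; apply: restr_class_mk. Qed.

Definition germ_category : category.
Proof.
refine (@Category C germ (fun A => mk_germ (idm_rle A)) germ_comp _ _ _).
- move=> A B f; have [k [p [kp ->]]] := germ_mkP f.
  by rewrite germ_comp_mk; apply: mk_germ_congr; rewrite comp1m.
- move=> A B f; have [k [p [kp ->]]] := germ_mkP f.
  by rewrite germ_comp_mk; apply: mk_germ_congr; rewrite compm1.
- move=> A B X Y h g f.
  have [j [r [jr ->]]] := germ_mkP h; have [l [q [lq ->]]] := germ_mkP g.
  have [k [p [kp ->]]] := germ_mkP f.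
  by rewrite !germ_comp_mk; apply: mk_germ_congr; rewrite compmA.
Defined.

Definition germ_rcategory : restriction_category.
Proof.
refine (@RestrictionCategory germ_category germ_restr _ _ _ _) => /=.
- move=> A B f; have [k [p [kp ->]]] := germ_mkP f.
  by rewrite germ_restr_mk germ_comp_mk; apply: mk_germ_congr; rewrite restrR1.
- move=> A B X f g; have [k [p [kp ->]]] := germ_mkP f.
  have [l [q [lq ->]]] := germ_mkP g.
  rewrite !germ_restr_mk !germ_comp_mk.
  by apply: mk_germ_congr; rewrite restrR2.
- move=> A B X f g; have [k [p [kp ->]]] := germ_mkP f.
  have [l [q [lq ->]]] := germ_mkP g.
  rewrite !germ_restr_mk !germ_comp_mk germ_restr_mk.
  by apply: mk_germ_congr; rewrite restrR3.
- move=> A B X f g; have [k [p [kp ->]]] := germ_mkP f.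
  have [l [q [lq ->]]] := germ_mkP g.
  rewrite !germ_restr_mk !germ_comp_mk germ_restr_mk germ_comp_mk.
  by apply: mk_germ_congr; rewrite restrR4.
Defined.

(** * The two factors *)

Definition localic_map (A B : C) (f : A ~> B) : germ A B :=
  mk_germ (rle_refl (fmap F f)).

Definition localic_functor : functor C germ_category.
Proof.
refine (@Functor C germ_category (fun A => A) localic_map _ _) => /=.
- by move=> A; apply: mk_germ_congr; rewrite ?fmap1.
- by move=> A B X g f; rewrite germ_comp_mk; apply: mk_germ_congr;
  rewrite ?fmapM.
Defined.

Definition localic_part : restriction_functor C germ_rcategory.
Proof.
refine (@RestrictionFunctor C germ_rcategory localic_functor _) => /= A B f.
by rewrite germ_restr_mk; apply: mk_germ_congr; rewrite ?fmap_restr.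
Defined.

Definition hyperconnected_functor : functor germ_category D :=
  @Functor germ_category D (fun A : C => F A) germ_val
    (fun _ => erefl) (fun _ _ _ _ _ => erefl).

Definition hyperconnected_part : restriction_functor germ_rcategory D :=
  @RestrictionFunctor germ_rcategory D hyperconnected_functor
    (fun _ _ _ => erefl).

(** Localicity of [localic_part] is thereby reduced to [agree_below k] being
    a partial equivalence relation, with [h] in its definition as the lower
    bound. *)
Lemma germ_rle_localic_map (A B : C) (k : F A ~> F B) (p : A ~> B)
    (kp : k ⩽ fmap F p) (f : A ~> B) :
  @rle germ_rcategory A B (mk_germ kp) (localic_map f) <-> agree_below k p f.
Proof.
rewrite /rle /= germ_restr_mk germ_comp_mk; split=> [kf | [h [hp hf kh]]].
  have: agree_below k p p by apply: agree_below_refl.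
  have /= <- := f_equal (@germ_class _ _) kf.
  have /= -> := f_equal (@germ_val _ _) kf.
  case=> h [hf hp kh]; exists h; split=> //.
  exact: rle_trans hf (rle_comp_restr _ _).
(* The lower bound [h] represents the same germ as [p] and is itself a
   restriction of [f]. *)
have kf : k ⩽ fmap F f := rle_trans kh (fmap_rle F hf).
apply: mk_germ_eq; first exact: kf.
rewrite (kf : _ = k); exists h; split=> //.
by rewrite -(hf : _ = h); apply: rle_comp; [apply: rle_refl | apply: rle_restr].
Qed.

Lemma localic_part_localic : localic localic_part.
Proof.
split; first by exists (fun A => A).
move=> A B /= m; have [k [p [kp ->]]] := germ_mkP m; split.
  by exists p; apply/germ_rle_localic_map; apply: agree_below_refl.
move=> f g /germ_rle_localic_map pf /germ_rle_localic_map pg.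
have [h [hf hg kh]] := agree_below_trans (agree_below_sym pf) pg.
exists h; split=> //; apply/germ_rle_localic_map.
apply: agree_below_trans pf _; exists h; split=> //; exact: rle_refl.
Qed.

(** This makes [e] the value of a germ represented by [idm A], which gives the
    inverse of the map induced by [hyperconnected_part] on idempotents. *)
Lemma ridem_rle_idm (A : C) (e : ridem (F A)) :
  proj1_sig e ⩽ fmap F (idm A).
Proof. by rewrite fmap1 -(proj2_sig e); apply: restr_rle_idm. Qed.

Lemma germ_of_ridem_subproof (A : C) (e : ridem (F A)) :
  @is_ridem germ_rcategory A (mk_germ (ridem_rle_idm e)).
Proof.
rewrite /is_ridem /= germ_restr_mk.
by apply: mk_germ_congr; [exact: (proj2_sig e) | exact: restr_idm].
Qed.

Definition germ_of_ridem (A : C) (e : ridem (F A)) : @ridem germ_rcategory A :=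
  exist _ (mk_germ (ridem_rle_idm e)) (germ_of_ridem_subproof e).

Lemma hyperconnected_part_hyperconnected : hyperconnected hyperconnected_part.
Proof.
move=> A; exists (@germ_of_ridem A) => [[m mm] | [e ee]]; last first.
  by apply: eq_exist_uncurried; exists erefl; apply: proof_irrelevance.
apply: subset_eq_compat => /=.
have [k [p [kp mE]]] := germ_mkP m.
(* As [m] is its own restriction, [restr p] represents it too, and it lies
   below the identity. *)
have mrE : m = mk_germ (restr_rle kp) by rewrite -germ_restr_mk -mE.
rewrite [RHS]mrE; apply: mk_germ_eq; first by rewrite /= mrE.
apply: agree_below_sym; rewrite /= mrE /=.
exists (restr p); split; first exact: rle_refl; first exact: restr_rle_idm.
exact: restr_rle.
Qed.

End Germs.

(** * The factorisation *)

(** A functor and its factorisation have convertible object and arrow maps, so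
    they differ only in the proofs of their laws. *)
Lemma restriction_functor_laws_irrelevance (C D : restriction_category)
    (o : C -> D) (m : forall A B : C, (A ~> B) -> (o A ~> o B)) m1 mM m1' mM' mR mR' :
  @RestrictionFunctor C D (@Functor C D o m m1 mM) mR =
  @RestrictionFunctor C D (@Functor C D o m m1' mM') mR'.
Proof.
move: mR mR'; rewrite (proof_irrelevance _ m1 m1') (proof_irrelevance _ mM mM').
by move=> mR mR'; rewrite (proof_irrelevance _ mR mR').
Qed.

Theorem proposition2p3 :
  forall (C D : restriction_category) (F : restriction_functor C D),
  exists (E : restriction_category)
         (H : restriction_functor C E) (K : restriction_functor E D),
    localic H /\ hyperconnected K /\ F = rfunctor_comp K H.
Proof.
move=> C D F.
exists (germ_rcategory F), (localic_part F), (hyperconnected_part F).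
split; first exact: localic_part_localic.
split; first exact: hyperconnected_part_hyperconnected.
case: F => [[o m m1 mM] mR]; exact: restriction_functor_laws_irrelevance.
Qed.
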